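(* Let $M$ be a model of DOAG or $M=\{0\}$, and let $\Gamma$ be a model of DOAG containing $M$. Let $D\subseteq\Gamma^m$ be an $M$-definable set. Let $g\colon D\to\Gamma$ be a Lipschitz function definable over $M$. Let $f_1,\ldots,f_n$ be $\mathbb{Q}$-affine functions over $M$ such that $g$ is a $w$-combination of $f_1,\ldots,f_n$. Then $g$ is an $(\ell,+)$-combination of the $f_i$, the constant $M$-valued functions and the coordinate functions.
   Context: DOAG is the theory of (non-trivial) divisible ordered abelian groups. A $\mathbb{Q}$-affine function over $M$ is a function of the form $\sum_i m_ix_i+c$ with $m_i\in\mathbb{Q}$ and $c\in M$; the $f_i$ and coordinate functions are considered restricted to $D$. For $x\in\Gamma^m$, $|x|=\max_i|x_i|$. A definable function $f\colon D\to\Gamma$ is Lipschitz if there is $N\in\mathbb{N}$ such that $|f(x)-f(y)|\leqslant N|x-y|$ for all $x,y\in D$. A continuous definable function $g\colon D\to\Gamma$ is a $w$-combination of continuous definable functions $f_1,\ldots,f_n\colon D\to\Gamma$ if for every $x\in D$ there is $i$ with $g(x)=f_i(x)$. It is an $(\ell,+)$-combination of a family of functions if $g$ can be described by a formula involving only $+,-,\min,\max$ and finitely many functions of the family. *)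

(* Defs.v *)
From mathcomp Require Import all_boot all_order all_algebra.
From mathcomp Require Import boolp classical_sets.

Set Implicit Arguments.
Unset Strict Implicit.
Unset Printing Implicit Defensive.

Import Order.TTheory GRing.Theory Num.Theory.
Local Open Scope classical_set_scope.
Local Open Scope ring_scope.

(* A, with the induced addition and order, is a model of DOAG.  All the axioms
   are stated here because the order of a [porderZmodType] need be neither
   total nor compatible with the addition. *)
Definition doag (G : porderZmodType) (A : set G) : Prop :=
  [/\ A 0 /\ (forall x y, A x -> A y -> A (x - y)),
      forall x y, A x -> A y -> (x <= y) || (y <= x),
      forall z x y, A z -> A x -> A y -> x <= y -> z + x <= z + y,
      exists2 x, A x & x != 0 &
      forall (n : nat) x, (0 < n)%N -> A x -> exists2 y, A y & y *+ n = x].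

(* Terms and formulas of the language (0, +, -, <) with free variables among
   the n variables indexed by 'I_n; Ex binds the variable of index 0. *)
Inductive term (n : nat) : Type :=
| Var of 'I_n
| Zero
| Add of term n & term n
| Opp of term n.

Inductive formula : nat -> Type :=
| Eq n of term n & term n : formula n
| Lt n of term n & term n : formula n
| And n of formula n & formula n : formula n
| Not n of formula n : formula n
| Ex n of formula n.+1 : formula n.

Section Definability.
Variable G : porderZmodType.

Fixpoint eval n (t : term n) (x : 'rV[G]_n) : G :=
  match t with
  | Var i => x 0 i
  | Zero => 0
  | Add t1 t2 => eval t1 x + eval t2 x
  | Opp t1 => - eval t1 x
  end.

Fixpoint holds n (phi : formula n) : 'rV[G]_n -> Prop :=
  match phi in formula n return 'rV[G]_n -> Prop with
  | Eq _ t u => fun x => eval t x = eval u x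
  | Lt _ t u => fun x => eval t x < eval u x
  | And _ p q => fun x => holds p x /\ holds q x
  | Not _ p => fun x => ~ holds p x
  | Ex n p => fun x =>
      exists y : G, holds p (row_mx (const_mx y : 'rV[G]_1) x)
  end.

(* The parameters a in A are substituted for the last k variables. *)
Definition definable (A : set G) m (D : set 'rV[G]_m) : Prop :=
  exists (k : nat) (phi : formula (m + k)) (a : 'rV[G]_k),
    (forall j, A (a 0 j)) /\ forall x, D x <-> holds phi (row_mx x a).

(* Functions D -> G are represented by total functions, of which only the
   restriction to D matters. *)
Definition graph m (D : set 'rV[G]_m) (g : 'rV[G]_m -> G)
  : set 'rV[G]_(m + 1) :=
  [set row_mx x (const_mx (g x)) | x in D].

Definition definable_fun (A : set G) m (D : set 'rV[G]_m) (g : 'rV[G]_m -> G)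
  : Prop := definable A (graph D g).

End Definability.

Section Functions.
Variables (G : porderZmodType) (m : nat).
Implicit Types (D : set 'rV[G]_m) (g h : 'rV[G]_m -> G).

Definition abs (x : G) : G := Order.max x (- x).

Definition norm (x : 'rV[G]_m) : G := \big[Order.max/0]_(i < m) abs (x 0 i).

Definition lipschitz D g : Prop :=
  exists N : nat, forall x y, D x -> D y ->
    abs (g x - g y) <= norm (x - y) *+ N.

(* Continuity for the order topology on G, the product topology on G^m and the
   induced topology on D (a nontrivial divisible ordered group has no least
   positive element). *)
Definition continuous_on D g : Prop :=
  forall x, D x -> forall e : G, 0 < e -> exists2 d : G, 0 < d &
    forall y, D y -> norm (y - x) < d -> abs (g y - g x) < e.

(* The element (p/q) x, i.e. the unique y with q y = p x when G is divisible
   (an ordered group is torsion-free). *)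
Definition qscale (q : rat) (x : G) : G :=
  xget 0 [set y | y *~ denq q = x *~ numq q].

Definition Qaffine (M : set G) g : Prop :=
  exists (q : 'I_m -> rat) (c : G), M c /\
    forall x, g x = \sum_(i < m) qscale (q i) (x 0 i) + c.

(* Here "definable" means definable with parameters in G. *)
Definition w_combination D n (f : 'I_n -> 'rV[G]_m -> G) g : Prop :=
  [/\ continuous_on D g /\ definable_fun [set: G] D g,
      forall i, continuous_on D (f i) /\ definable_fun [set: G] D (f i) &
      forall x, D x -> exists i, g x = f i x].

Inductive lplus_expr (F : set ('rV[G]_m -> G)) : ('rV[G]_m -> G) -> Prop :=
| LP_gen h : F h -> lplus_expr F h
| LP_add h1 h2 : lplus_expr F h1 -> lplus_expr F h2 ->
    lplus_expr F (fun x => h1 x + h2 x)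
| LP_sub h1 h2 : lplus_expr F h1 -> lplus_expr F h2 ->
    lplus_expr F (fun x => h1 x - h2 x)
| LP_min h1 h2 : lplus_expr F h1 -> lplus_expr F h2 ->
    lplus_expr F (fun x => Order.min (h1 x) (h2 x))
| LP_max h1 h2 : lplus_expr F h1 -> lplus_expr F h2 ->
    lplus_expr F (fun x => Order.max (h1 x) (h2 x)).

Definition lplus_combination D (F : set ('rV[G]_m -> G)) g : Prop :=
  exists2 h, lplus_expr F h & forall x, D x -> g x = h x.

Definition const_fun (c : G) : 'rV[G]_m -> G := fun=> c.

Definition coord_fun (j : 'I_m) : 'rV[G]_m -> G := fun x => x 0 j.

End Functions.

(* Main.v *)
Require Import Defs.
From mathcomp Require Import all_boot all_order all_algebra.
From mathcomp Require Import boolp classical_sets.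

(** Quantifier elimination in divisible ordered abelian groups shows that the
    graph of g is a finite union of convex polyhedra cut out by strict and weak
    inequalities with integer coefficients and constants in M
    ([definable_semilinear]).  Intersecting each of them with the graphs of the
    f_i covers D by finitely many pieces P, on each of which g is one f_i.  It
    suffices to find for every nonempty P a function h in the class considered
    with h <= g on D and h = g on P: then g is the maximum of these h
    ([lplus_of_pieces]).

    The candidate is h = f_i - R e, where e(x) is the total amount by which the
    point (x, f_i(x)) violates the inequalities that define P.  These
    inequalities are integer combinations of the coordinates, of f_i and of
    constants in M, so e is in the class; no division is needed, since the
    point is taken on the graph of f_i rather than over its domain.  Clearly
    h = g on P.  For h <= g on D, take x in D and a point z of P.  Both g and
    f_i are Lipschitz and agree at z, so f_i(x) - g(x) is at most a constant
    multiple of |x - z|; it remains to choose z with |x - z| bounded by a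
    multiple of e(x).  This is Hoffman's error bound for systems of linear
    inequalities ([hoffman]).  With strict inequalities, and over a possibly
    non-archimedean group, it takes the form: if (x, f_i(x)) violates every
    inequality by less than r, then some z in P has |x - z| <= K r.  Letting r
    decrease to e(x) gives h <= g ([og_le_limit], [lower_piece]).

    Fourier-Motzkin elimination ([fm_elim]) serves twice: as the quantifier
    elimination step, and in the proof of the error bound by induction on the
    dimension.  The induction works because the eliminated system consists of
    positive combinations of the original one, so a point that nearly
    satisfies the original system nearly satisfies the eliminated one
    ([fm_relax]). *)

Import Order.TTheory GRing.Theory Num.Theory.
Local Open Scope classical_set_scope.
Local Open Scope ring_scope.
Set Implicit Arguments.
Unset Strict Implicit.
Unset Printing Implicit Defensive.

(** * Ordered group arithmetic *)

Section OrderedGroup.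
Variables (G : porderZmodType) (hG : doag [set: G]).

Section Arithmetic.
Implicit Types (x y z r d : G) (s : bool) (n : nat).

Lemma og_total x y : (x >=< y)%O.
Proof. by case: hG => _ + _ _ _; apply. Qed.

Lemma og_leD2l z x y : (z + x <= z + y) = (x <= y).
Proof.
case: hG => _ _ hD _ _; have {}hD (u v w : G) : v <= w -> u + v <= u + w.
  by move=> vw; apply: hD.
by apply/idP/idP => [/(hD (- z))|]; [rewrite !addKr|apply: hD].
Qed.

Lemma og_subr_ge0 x y : (0 <= y - x) = (x <= y).
Proof. by rewrite -(og_leD2l x 0) addr0 subrKC. Qed.

Lemma og_ltNge x y : (x < y) = ~~ (y <= x).
Proof. by rewrite comparable_ltNge // og_total. Qed.

Lemma og_leNgt x y : (x <= y) = ~~ (y < x).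
Proof. by rewrite comparable_leNgt // og_total. Qed.

Lemma og_subr_gt0 x y : (0 < y - x) = (x < y).
Proof. by rewrite !lt_def og_subr_ge0 subr_eq0. Qed.

Lemma og_oppr_ge0 x : (0 <= - x) = (x <= 0).
Proof. by rewrite -(og_subr_ge0 x) sub0r. Qed.

Lemma og_addr_ge0 x y : 0 <= x -> 0 <= y -> 0 <= x + y.
Proof. by move=> x0; rewrite -(og_leD2l x) addr0; apply: le_trans. Qed.

Lemma og_addr_gt0 x y : 0 < x -> 0 <= y -> 0 < x + y.
Proof.
move=> x0; rewrite -(og_leD2l x) addr0; exact: lt_le_trans.
Qed.

Lemma og_mulrn_ge0 n x : 0 <= x -> 0 <= x *+ n.
Proof.
by move=> x0; elim: n => [|n IH]; rewrite ?mulr0n// mulrS og_addr_ge0.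
Qed.

Lemma og_leD x y z t : x <= y -> z <= t -> x + z <= y + t.
Proof.
move=> xy zt; apply: (@le_trans _ _ (x + t)); first by rewrite og_leD2l.
by rewrite ![_ + t]addrC og_leD2l.
Qed.

Lemma og_leMn n x y : x <= y -> x *+ n <= y *+ n.
Proof.
rewrite -og_subr_ge0 -(og_subr_ge0 (x *+ n)) -mulrnBl; exact: og_mulrn_ge0.
Qed.

Lemma og_leMnr x n k : 0 <= x -> (n <= k)%N -> x *+ n <= x *+ k.
Proof.
move=> x0 /subnK <-; rewrite -og_subr_ge0 mulrnDr addrK.
exact: og_mulrn_ge0.
Qed.

Lemma og_lerBl x y z : (x - y <= z) = (x <= z + y).
Proof. by rewrite -(og_leD2l y (x - y)) subrKC addrC. Qed.

Lemma og_div n x : (0 < n)%N -> exists y, y *+ n = x.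
Proof.
by case: hG => _ _ _ _ h /h h0; case: (h0 x I) => y _ <-; exists y.
Qed.

Lemma og_divz (h : int) x : h != 0 -> exists y, y *~ h = x.
Proof.
case: h => [h|h] h0; first by apply: og_div; rewrite lt0n.
have [y hy] := @og_div h.+1 (- x) isT.
by exists y; rewrite NegzE mulrNz -pmulrn hy opprK.
Qed.

Lemma og_gt0_exists : exists x : G, 0 < x.
Proof.
case: hG => _ _ _ [x _ xn0] _; case/orP: (og_total x 0) => h.
  by exists (- x); rewrite lt_def og_oppr_ge0 h oppr_eq0 xn0.
by exists x; rewrite lt_def xn0.
Qed.

(** The two kinds of constraint of a polyhedron, strict and weak, treated
    alike. *)
Definition pos (s : bool) x : bool := if s then 0 < x else 0 <= x.

Lemma pos_ge0 s x : pos s x -> 0 <= x.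
Proof. by case: s => //=; apply: ltW. Qed.

Lemma pos_gt0 s x : 0 < x -> pos s x.
Proof. by case: s => //=; apply: ltW. Qed.

Lemma posD s t x y : pos s x -> pos t y -> pos (s || t) (x + y).
Proof.
case: s => /=; first by move=> x0 /pos_ge0; apply: og_addr_gt0.
case: t => /=; last exact: og_addr_ge0.
by move=> x0 y0; rewrite addrC og_addr_gt0.
Qed.

Lemma posN s x : pos s (- x) = ~~ pos (~~ s) x.
Proof.
case: s => /=; first by rewrite -og_ltNge -(og_subr_gt0 x 0) sub0r.
by rewrite -og_leNgt -(og_subr_ge0 x 0) sub0r.
Qed.

(** The converse is the direct implication for - x and the opposite strictness,
    by totality ([posN]). *)
Lemma posMn s n x : (0 < n)%N -> pos s (x *+ n) = pos s x.
Proof.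
move=> n0; have im t y : pos t y -> pos t (y *+ n).
  case: n n0 => // n _; rewrite mulrS -{2}(orbF t) => y0.
  by apply: posD => //; apply: og_mulrn_ge0; apply: pos_ge0 y0.
apply/idP/idP; last exact: im.
by apply: contraTT; rewrite -[s]negbK -!posN -mulNrn; apply: im.
Qed.

Lemma og_mulrn_le n x r : (0 < n)%N -> 0 <= r -> x *+ n <= r -> x <= r.
Proof.
move=> n0 r0 xr; case/orP: (og_total x 0) => x0; first exact: le_trans x0 r0.
by apply: le_trans xr; rewrite -[x in X in X <= _]mulr1n; apply: og_leMnr.
Qed.

Lemma og_mulrn_inj n x y : (0 < n)%N -> x *+ n = y *+ n -> x = y.
Proof.
move=> n0 /eqP; rewrite -subr_eq0 -mulrnBl => /eqP h; apply: le_anti.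
apply/andP; split; rewrite -og_subr_ge0 -/(pos false _) -(@posMn _ n) //=.
  by rewrite -opprB mulNrn h oppr0.
by rewrite h.
Qed.

(** The order is dense enough to pass to the limit: a gap between the two sides
    could be divided by n + 1 and would leave room for some d > r. *)
Lemma og_le_limit x y r n :
  (forall d, r < d -> x - d *+ n <= y) -> x - r *+ n <= y.
Proof.
move=> h; rewrite og_leNgt -og_subr_gt0; apply/negP => gap.
have [e he] := @og_div n.+1 (x - r *+ n - y) isT.
have e0 : 0 < e by rewrite -/(pos true _) -(@posMn _ n.+1) //= he.
have : x - (r + e) *+ n <= y.
  by apply: h; rewrite -og_subr_gt0 addrAC subrr add0r.
rewrite mulrnDl opprD addrA og_lerBl [y + _]addrC -og_lerBl -he mulrSr.
by rewrite -{2}[e *+ n]addr0 og_leD2l og_leNgt e0.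
Qed.

Lemma og_ge_max z x y : (Order.max x y <= z) = (x <= z) && (y <= z).
Proof. by rewrite comparable_ge_max // og_total. Qed.

Lemma og_le_max z x y : (z <= Order.max x y) = (z <= x) || (z <= y).
Proof. by rewrite comparable_le_max // og_total. Qed.

Lemma abs_ge0 x : 0 <= abs x.
Proof.
rewrite og_leNgt; apply/negP=> h; have := ltW h.
rewrite og_ge_max => /andP[x0]; rewrite -og_oppr_ge0 opprK => x0'.
move: h; have -> : x = 0 by apply: le_anti; rewrite x0.
by rewrite /abs oppr0 maxxx ltxx.
Qed.

Lemma abs_le x r : (abs x <= r) = (x <= r) && (- x <= r).
Proof. exact: og_ge_max. Qed.

Lemma abs_mulrz x (z : int) r : abs x <= r -> x *~ z <= r *+ `|z|.
Proof.
rewrite abs_le => /andP[h1 h2]; case: z => [a|a]; first exact: og_leMn.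
by rewrite NegzE mulrNz -mulNrz; apply: og_leMn.
Qed.

Lemma norm_le m (x : 'rV[G]_m) r :
  0 <= r -> (norm x <= r) = [forall i, abs (x 0 i) <= r].
Proof.
move=> r0; have -> : [forall i, abs (x 0 i) <= r] =
    all (fun i => abs (x 0 i) <= r) (index_enum 'I_m).
  by apply/forallP/allP => [h i _|h i]; [apply: h|apply/h/mem_index_enum].
rewrite /norm; elim: (index_enum _) => [|i e IH]; first by rewrite big_nil r0.
by rewrite big_cons og_ge_max IH.
Qed.

Lemma norm_ge0 m (x : 'rV[G]_m) : 0 <= norm x.
Proof.
rewrite /norm; elim: (index_enum _) => [|i e IH]; first by rewrite big_nil.
rewrite big_cons /Order.max; case: ifP => // _; exact: abs_ge0.
Qed.

Lemma abs_le_norm m (x : 'rV[G]_m) i : abs (x 0 i) <= norm x.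
Proof.
by move: (lexx (norm x)); rewrite {1}norm_le ?norm_ge0// => /forallP.
Qed.

End Arithmetic.

(** * Integer affine forms and systems of inequalities *)

Lemma finite_bound (T : eqType) (s : seq T) (P : T -> nat -> Prop) :
  (forall a k l, (k <= l)%N -> P a k -> P a l) ->
  (forall a, a \in s -> exists k, P a k) ->
  exists K, forall a, a \in s -> P a K.
Proof.
move=> mono; elim: s => [|a s IH] hs; first by exists 0%N.
have [K hK] : exists K, forall a, a \in s -> P a K.
  by apply: IH => b bs; apply: hs; rewrite inE bs orbT.
have [k hk] := hs a (mem_head _ _).
exists (maxn k K) => b; rewrite inE => /orP[/eqP->|/hK].
  by apply: mono hk; rewrite leq_maxl.
by apply: mono; rewrite leq_maxr.
Qed.

(** A pair makes affine forms an additive group, so that sums, opposites and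
    multiples of forms come for free. *)
Definition aff n : Type := ('rV[int]_n * G)%type.
Definition aeval n (l : aff n) (v : 'rV[G]_n) : G :=
  \sum_i v 0 i *~ l.1 0 i + l.2.

Lemma aevalD n (l k : aff n) v : aeval (l + k) v = aeval l v + aeval k v.
Proof.
rewrite /aeval addrACA -big_split; congr (_ + _).
by apply: eq_bigr => i _ /=; rewrite mxE mulrzDr.
Qed.

Lemma aevalN n (l : aff n) v : aeval (- l) v = - aeval l v.
Proof.
rewrite /aeval opprD -sumrN; congr (_ + _).
by apply: eq_bigr => i _ /=; rewrite mxE mulrNz.
Qed.

Lemma aeval0 n v : aeval (0 : aff n) v = 0.
Proof. by rewrite /aeval addr0 big1 // => i _; rewrite mxE mulr0z. Qed.

Lemma aevalMn n (l : aff n) k v : aeval (l *+ k) v = aeval l v *+ k.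
Proof.
by elim: k => [|k IH]; rewrite ?aeval0 ?mulr0n// !mulrS aevalD IH.
Qed.

(** The boolean says whether the form is required to be positive or only
    nonnegative; an equation is a pair of weak inequalities. *)
Definition lit n : Type := (bool * aff n)%type.
Definition sat n (C : seq (lit n)) (v : 'rV[G]_n) : Prop :=
  forall l, l \in C -> pos l.1 (aeval l.2 v).
(** The bound d is strict and shared by strict and weak literals: the relaxation
    forgets which inequalities were strict. *)
Definition relaxed n (C : seq (lit n)) d (v : 'rV[G]_n) : Prop :=
  forall l, l \in C -> 0 < aeval l.2 v + d.

Definition vcons n y (v : 'rV[G]_n) : 'rV[G]_n.+1 :=
  row_mx (const_mx y : 'rV[G]_1) v.
Definition hcoef n (l : aff n.+1) : int := l.1 0 ord0.
Definition taff n (l : aff n.+1) : aff n := (\row_i l.1 0 (lift ord0 i), l.2).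

Lemma vcons0 n y (v : 'rV[G]_n) : vcons y v 0 ord0 = y.
Proof.
have := row_mxEl (const_mx y : 'rV[G]_1) v 0 ord0.
by rewrite lshift0 [in RHS]mxE.
Qed.

Lemma vconsS n y (v : 'rV[G]_n) i : vcons y v 0 (lift ord0 i) = v 0 i.
Proof. by have := row_mxEr (const_mx y : 'rV[G]_1) v 0 i; rewrite rshift1. Qed.

Lemma vconsP n (w : 'rV[G]_n.+1) : exists y v, w = vcons y v.
Proof.
exists (w 0 ord0), (\row_i w 0 (lift ord0 i)); apply/rowP => i.
by case: (unliftP ord0 i) => [j|] ->; rewrite ?vcons0 ?vconsS ?mxE.
Qed.

Lemma aeval_vcons n (l : aff n.+1) y v :
  aeval l (vcons y v) = y *~ hcoef l + aeval (taff l) v.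
Proof.
rewrite /aeval big_ord_recl vcons0 -addrA; congr (_ + (_ + _)).
by apply: eq_bigr => i _; rewrite vconsS mxE.
Qed.

(** * Fourier-Motzkin elimination *)

(** The positive combination of p and q in which the first variable cancels when
    its coefficients have opposite signs. *)
Definition combine n (p q : lit n.+1) : lit n :=
  (p.1 || q.1, taff p.2 *+ `|hcoef q.2| + taff q.2 *+ `|hcoef p.2|).

(** One elimination step: lower bounds on the first variable (positive
    coefficient) are confronted with upper bounds (negative coefficient). *)
Definition fm n (C : seq (lit n.+1)) : seq (lit n) :=
  [seq (l.1, taff l.2) | l <- C & hcoef l.2 == 0] ++
  [seq combine p q | p <- [seq l <- C | 0 < hcoef l.2],
                     q <- [seq l <- C | hcoef l.2 < 0]].

Lemma fmP n (C : seq (lit n.+1)) k : k \in fm C ->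
  (exists2 l, l \in C & hcoef l.2 = 0 /\ k = (l.1, taff l.2)) \/
  (exists p q, [/\ p \in C, q \in C, 0 < hcoef p.2, hcoef q.2 < 0 &
                   k = combine p q]).
Proof.
rewrite mem_cat => /orP[/mapP[l]|/allpairsP[[p q] /=]].
  by rewrite mem_filter => /andP[/eqP h lC ->]; left; exists l.
rewrite !mem_filter => -[/andP[p0 pC] /andP[q0 qC] ->].
by right; exists p, q.
Qed.

Lemma combine_eval n (p q : lit n.+1) y v : 0 < hcoef p.2 -> hcoef q.2 < 0 ->
  aeval (combine p q).2 v =
  aeval p.2 (vcons y v) *+ `|hcoef q.2| + aeval q.2 (vcons y v) *+ `|hcoef p.2|.
Proof.
rewrite aevalD !aevalMn !aeval_vcons.
move: (aeval (taff p.2) v) (aeval (taff q.2) v) => P Q.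
case: (hcoef p.2) => // a _; case: (hcoef q.2) => // b _.
rewrite !mulrnDl addrACA -pmulrn NegzE mulrNz -pmulrn mulNrn /= -!mulrnA.
by rewrite mulnC subrr add0r.
Qed.

(** The midpoint of the two bounds on the first variable works in every case.
    With coefficients a and - b and remaining forms P and Q, it is the y with
    2 a b y = a Q - b P, and then 2 b (a y + P) = a Q + b P = 2 a (Q - b y), so
    both constraints hold with the strictness of the combined one. *)
Lemma combine_complete n (p q : lit n.+1) v :
  0 < hcoef p.2 -> hcoef q.2 < 0 ->
  pos (combine p q).1 (aeval (combine p q).2 v) ->
  exists y, pos p.1 (aeval p.2 (vcons y v)) /\ pos q.1 (aeval q.2 (vcons y v)).
Proof.
rewrite aevalD !aevalMn /=.
under eq_exists do rewrite !aeval_vcons.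
case: (hcoef p.2) => // -[//|a] _; case: (hcoef q.2) => // b _ /=.
move: (aeval (taff p.2) v) (aeval (taff q.2) v) => P Q h.
have hw s : s ==> (p.1 || q.1) -> pos s (P *+ b.+1 + Q *+ a.+1).
  case: s => //= [h1|_]; first by move: h; rewrite h1.
  exact: pos_ge0 h.
have [y hy] := @og_div (a.+1 * b.+1 * 2) (Q *+ a.+1 - P *+ b.+1) isT.
exists y; split.
  rewrite -(@posMn _ (b.+1 * 2)) // mulrnDl -pmulrn -mulrnA mulnA hy.
  rewrite [P *+ (_ * _)]mulrnA mulr2n addrA subrK addrC.
  by apply: hw; case: p.1.
rewrite -(@posMn _ (a.+1 * 2)) // mulrnDl.
rewrite NegzE mulrNz -pmulrn mulNrn -mulrnA mulnCA mulnA hy opprB.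
rewrite [Q *+ (_ * _)]mulrnA mulr2n addrA subrK.
by apply: hw; case: q.1; rewrite ?orbT.
Qed.

(** Up-closed subsets of a total order form a chain, so finitely many of them
    have a least one.  Working with the sets rather than with their end points
    avoids comparing strict with weak bounds. *)
Lemma least_upset (T : eqType) (s : seq T) (U : T -> pred G) :
  (forall a x y, a \in s -> x <= y -> U a x -> U a y) ->
  s = [::] \/ exists2 a, a \in s & forall b x, b \in s -> U a x -> U b x.
Proof.
elim: s => [|a s IH] up; first by left.
right; case: IH => [b x y bs|->|[b bs hb]].
- by apply: up; rewrite inE bs orbT.
- by exists a; rewrite ?mem_head// => b x; rewrite inE => /eqP->.
case: (pselect (forall x, U a x -> U b x)) => [ab|].
  exists a; rewrite ?mem_head// => c x; rewrite inE => /orP[/eqP->//|cs].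
  by move=> /ab; apply: hb.
move=> /existsNP[z /not_implyP[az /negP bz]].
exists b; first by rewrite inE bs orbT.
move=> c x; rewrite inE => /orP[/eqP->|cs]; last exact: hb.
case/orP: (og_total x z) => [xz bx|zx _]; last exact: (up a z x (mem_head _ _)).
by case/negP: bz; apply: (up b x z) bx => //; rewrite inE bs orbT.
Qed.

Lemma aeval_shift n (l : aff n.+1) y e v :
  aeval l (vcons (y + e) v) = aeval l (vcons y v) + e *~ hcoef l.
Proof. by rewrite !aeval_vcons mulrzDl addrAC. Qed.

Lemma pos_shift n (l : lit n.+1) y e v : 0 <= e *~ hcoef l.2 ->
  pos l.1 (aeval l.2 (vcons y v)) -> pos l.1 (aeval l.2 (vcons (y + e) v)).
Proof.
by rewrite aeval_shift => e0 h; rewrite -[l.1]orbF; apply: (@posD _ false).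
Qed.

Lemma lit_nonempty n (l : lit n.+1) v : hcoef l.2 != 0 ->
  exists y, pos l.1 (aeval l.2 (vcons y v)).
Proof.
move=> l0; have [e e0] := og_gt0_exists.
have [y hy] := og_divz (e - aeval (taff l.2) v) l0.
by exists y; rewrite aeval_vcons hy subrK pos_gt0.
Qed.

(** By [least_upset] one lower bound implies all the others, and dually for the
    upper bounds; so pairwise compatibility, [combine_complete], is enough. *)
Lemma fm_elim n (C : seq (lit n.+1)) v :
  sat (fm C) v <-> exists y, sat C (vcons y v).
Proof.
split; last first.
  move=> [y hy] k /fmP[[l lC [l0 ->]]|[p [q [pC qC p0 q0 ->]]]].
    by have := hy l lC; rewrite aeval_vcons l0 mulr0z add0r.
  rewrite (combine_eval y) //; have hp := hy p pC; have hq := hy q qC.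
  by apply: posD; rewrite posMn // absz_gt0; [rewrite lt_eqF|rewrite gt_eqF].
move=> hv; set L := [seq l <- C | 0 < hcoef l.2].
set R := [seq l <- C | hcoef l.2 < 0].
have hC l : l \in C -> [\/ l \in L, l \in R | hcoef l.2 = 0].
  move=> lC; rewrite !mem_filter lC !andbT.
  by case: (ltgtP (hcoef l.2) 0) => h; [apply: Or32|apply: Or31|apply: Or33].
have h0 l y : l \in C -> hcoef l.2 = 0 -> pos l.1 (aeval l.2 (vcons y v)).
  move=> lC l0; rewrite aeval_vcons l0 mulr0z add0r.
  apply: (hv (l.1, taff l.2)); rewrite mem_cat; apply/orP; left.
  by apply/mapP; exists l; rewrite // mem_filter l0 eqxx.
have hLR p q : p \in L -> q \in R ->
    exists y,
      pos p.1 (aeval p.2 (vcons y v)) /\ pos q.1 (aeval q.2 (vcons y v)).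
  move=> pL qR; move: (pL) (qR); rewrite !mem_filter.
  move=> /andP[p0 pC] /andP[q0 qC]; apply: combine_complete => //.
  apply: hv; rewrite mem_cat; apply/orP; right.
  by apply/allpairsP; exists (p, q).
pose inL y (l : lit n.+1) := pos l.1 (aeval l.2 (vcons y v)).
have upL l x y : l \in L -> x <= y -> inL x l -> inL y l.
  rewrite mem_filter => /andP[l0 _]; rewrite -og_subr_ge0 => xy.
  rewrite /inL -(subrKC x y); apply: pos_shift.
  by case: (hcoef l.2) l0 => // a _; rewrite -pmulrn og_mulrn_ge0.
(* Upper bounds are up-closed in the opposite of the variable. *)
have upR l x y : l \in R -> x <= y -> inL (- x) l -> inL (- y) l.
  rewrite mem_filter => /andP[l0 _]; rewrite -og_subr_ge0 => xy.
  rewrite /inL -(subrKC (- x) (- y)); apply: pos_shift.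
  case: (hcoef l.2) l0 => // a _; rewrite NegzE mulrNz -mulNrz -pmulrn.
  by rewrite opprD !opprK og_mulrn_ge0.
have [y [yL yR]] : exists y,
    (forall l, l \in L -> inL y l) /\ (forall l, l \in R -> inL y l).
  have hL : L = [::] \/ exists2 p, p \in L &
      forall l x, l \in L -> inL x p -> inL x l := least_upset upL.
  have hR : R = [::] \/ exists2 q, q \in R &
      forall l x, l \in R -> inL (- x) q -> inL (- x) l := least_upset upR.
  case: hL hR => [->|[p pL hp]] [->|[q qR hq]]; first by exists 0.
  - have q0 : hcoef q.2 != 0.
      by move: qR; rewrite mem_filter => /andP[/lt_eqF->].
    have [y hy] := lit_nonempty v q0; exists y; split=> // l lR.
    by rewrite -(opprK y); apply: hq => //; rewrite opprK.
  - have p0 : hcoef p.2 != 0.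
      by move: pL; rewrite mem_filter => /andP[/gt_eqF->].
    by have [y hy] := lit_nonempty v p0; exists y; split=> // l lL; apply: hp.
  - have [y [yp yq]] := hLR p q pL qR; exists y; split=> l ?; first exact: hp.
    by rewrite -(opprK y); apply: hq => //; rewrite opprK.
by exists y => l lC; case: (hC l lC) => [/yL|/yR|/h0] //; apply.
Qed.

(** The eliminated system is made of combinations with bounded nonnegative
    integer coefficients of the original one, hence the constant K. *)
Lemma fm_relax n (C : seq (lit n.+1)) : exists K : nat, forall d y v,
  0 < d -> relaxed C d (vcons y v) -> relaxed (fm C) (d *+ K) v.
Proof.
pose P (k : lit n) K := forall d y v, 0 < d -> relaxed C d (vcons y v) ->
  0 < aeval k.2 v + d *+ K.
have [||K hK] := @finite_bound _ (fm C) P.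
- move=> k K K' KK' hk d y v d0 /(hk d y v d0) h.
  have := og_addr_gt0 h (og_mulrn_ge0 (K' - K) (ltW d0)).
  by rewrite -addrA -mulrnDr subnKC.
- move=> k /fmP[[l lC [l0 ->]]|[p [q [pC qC p0 q0 ->]]]].
    exists 1%N => d y v d0 /(_ l lC).
    by rewrite aeval_vcons l0 mulr0z add0r.
  exists (`|hcoef q.2| + `|hcoef p.2|)%N => d y v d0 hC.
  rewrite (combine_eval y) // mulrnDr addrACA -!mulrnDl.
  have hp := hC p pC; have hq := hC q qC.
  apply: (@posD true true); rewrite (@posMn true) //.
    by rewrite absz_gt0 lt_eqF.
  by rewrite absz_gt0 gt_eqF.
by exists K => d y v d0 hC k kC; apply: hK hC.
Qed.

(** * Hoffman's error bound *)

(** Moving from t towards a solution t0 by the allowed violation d: a lower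
    bound has an integer coefficient at least 1 and is repaired by the move,
    and an upper bound that holds at t0 holds at every smaller value. *)
Lemma clamp_up n (l : lit n.+1) t t0 d v :
  0 < d -> t + d <= t0 -> 0 < aeval l.2 (vcons t v) + d ->
  pos l.1 (aeval l.2 (vcons t0 v)) -> pos l.1 (aeval l.2 (vcons (t + d) v)).
Proof.
move=> d0; rewrite -og_subr_ge0 => tt0 ht ht0.
case h: (hcoef l.2) => [[|a]|a].
- by move: ht0; rewrite !aeval_vcons h !mulr0z.
- rewrite aeval_shift h -pmulrn mulrS addrA; apply: pos_gt0.
  by apply: og_addr_gt0 ht _; rewrite og_mulrn_ge0 // ltW.
- rewrite -(subrKC t0 (t + d)); apply: pos_shift => //.
  by rewrite h NegzE mulrNz -mulNrz opprB -pmulrn og_mulrn_ge0.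
Qed.

Lemma clamp_down n (l : lit n.+1) t t0 d v :
  0 < d -> t0 <= t - d -> 0 < aeval l.2 (vcons t v) + d ->
  pos l.1 (aeval l.2 (vcons t0 v)) -> pos l.1 (aeval l.2 (vcons (t - d) v)).
Proof.
move=> d0; rewrite -og_subr_ge0 => tt0 ht ht0.
case h: (hcoef l.2) => [[|a]|a].
- by move: ht0; rewrite !aeval_vcons h !mulr0z.
- rewrite -(subrKC t0 (t - d)); apply: pos_shift => //.
  by rewrite h -pmulrn og_mulrn_ge0.
- rewrite aeval_shift h NegzE mulrNz -mulNrz opprK -pmulrn mulrS addrA.
  by apply: pos_gt0; apply: og_addr_gt0 ht _; rewrite og_mulrn_ge0 // ltW.
Qed.

(** The error bound in dimension one, with constant 1. *)
Lemma clamp n (C : seq (lit n.+1)) t t0 d v :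
  0 < d -> relaxed C d (vcons t v) -> sat C (vcons t0 v) ->
  exists2 z, sat C (vcons z v) & abs (t - z) <= d.
Proof.
move=> d0 ht ht0; have d0' := ltW d0.
have nd : - d <= d by rewrite -og_subr_ge0 opprK og_addr_ge0.
case: (boolP (t + d <= t0)) => [td|].
  exists (t + d); first by move=> l lC; apply: clamp_up (ht l lC) (ht0 l lC).
  by rewrite abs_le opprB addrAC subrr add0r opprD addrA subrr add0r nd lexx.
rewrite -og_ltNge => /ltW tt0.
case: (boolP (t0 <= t - d)) => [td|].
  exists (t - d); first by move=> l lC; apply: clamp_down (ht l lC) (ht0 l lC).
  by rewrite abs_le subKr nd lexx.
rewrite -og_ltNge => /ltW t0t; exists t0 => //.
rewrite abs_le opprB !og_lerBl; apply/andP; split; last by rewrite addrC.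
by rewrite addrC -og_lerBl.
Qed.

Lemma row_subE n (x y : 'rV[G]_n) i : (x - y) 0 i = x 0 i - y 0 i.
Proof. by rewrite !mxE. Qed.

Lemma aeval_lipschitz n (l : aff n) : exists S : nat, forall (x y : 'rV[G]_n) r,
  0 <= r -> norm (x - y) <= r -> aeval l x - aeval l y <= r *+ S.
Proof.
exists (\sum_i `|l.1 0%R i|)%N => x y r r0; rewrite norm_le // => /forallP h.
rewrite /aeval opprD addrACA subrr addr0 -sumrB -sumrMnr.
elim/big_ind2: _ => // [a b c d|i _]; first exact: og_leD.
by rewrite -mulrzBl; have := h i; rewrite !mxE; apply: abs_mulrz.
Qed.

(** Induction on the dimension: [fm_relax] and the induction hypothesis move the
    last coordinates into the projection of the solution set, which disturbs
    the violations by a controlled amount ([aeval_lipschitz]); the first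
    coordinate is then repaired in the fibre by [clamp]. *)
Lemma hoffman n (C : seq (lit n)) : (exists z : 'rV[G]_n, sat C z) ->
  exists K : nat, forall (y : 'rV[G]_n) d, 0 < d -> relaxed C d y ->
    exists2 z : 'rV[G]_n, sat C z & norm (y - z) <= d *+ K.
Proof.
elim: n C => [|n IH] C [z0 hz0].
  exists 0%N => y d d0 _; exists z0 => //.
  by rewrite norm_le //; apply/forallP => -[].
have [t0 [v0 z0E]] := vconsP z0.
have [|K1 hK1] := IH (fm C).
  by exists v0; apply/fm_elim; exists t0; rewrite -z0E.
have [K2 hK2] := fm_relax C.
pose P (l : lit n.+1) S := forall (x y : 'rV[G]_n) r,
  0 <= r -> norm (x - y) <= r ->
  aeval (taff l.2) x - aeval (taff l.2) y <= r *+ S.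
have [||S hS] := @finite_bound _ C P.
- move=> l k k' kk' hk x y r r0 /(hk x y r r0) /le_trans; apply.
  exact: og_leMnr.
- by move=> l _; apply: aeval_lipschitz.
pose R := (K2.+1 * K1)%N.
(* The first coordinate moves by (R S + 1) d, the other ones by R d. *)
exists ((R * S).+1 + R)%N => y d d0; have [t [v ->]] := vconsP y => hC.
have d0' := ltW d0.
have [||z hz] := hK1 v (d *+ K2.+1).
- by rewrite mulrSr addrC og_addr_gt0 // og_mulrn_ge0.
- move=> k kC; rewrite mulrSr addrA.
  by apply: og_addr_gt0 => //; apply: hK2 hC _ kC.
rewrite -mulrnA -/R => vz; have r0 : 0 <= d *+ R by rewrite og_mulrn_ge0.
have [t1 ht1] : exists t, sat C (vcons t z) by apply/fm_elim.
have [||t2 ht2 tt2] := @clamp _ C t t1 (d *+ (R * S).+1) z _ _ ht1.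
- by rewrite mulrS og_addr_gt0 // og_mulrn_ge0.
- move=> l lC; have := hC l lC; have := hS l lC v z _ r0 vz.
  rewrite -og_subr_ge0 !aeval_vcons => h1 h2.
  have := og_addr_gt0 h2 h1.
  rewrite opprB mulrS mulrnA; congr (0 < _).
  move: (t *~ _) (aeval _ v) (aeval _ z) (d *+ R *+ S) => a b c e.
  rewrite -!addrA; congr (_ + _).
  by rewrite addrC !addrA subrK [LHS]addrC addrA.
exists (vcons t2 z) => //; rewrite norm_le ?og_mulrn_ge0 //.
apply/forallP => i; rewrite row_subE; case: (unliftP ord0 i) => [j|] ->.
  rewrite !vconsS; apply: le_trans (og_leMnr d0' (leq_addl _ _)).
  by have := abs_le_norm (v - z) j; rewrite row_subE => /le_trans; apply.
by rewrite !vcons0; apply: le_trans tt2 _; apply: og_leMnr; rewrite // leq_addr.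
Qed.

(** * Quantifier elimination *)

Section Semilinear.
Variables (M : set G) (M0 : M 0) (MB : forall x y, M x -> M y -> M (x - y)).

Lemma M_oppr x : M x -> M (- x).
Proof. by move=> Mx; rewrite -sub0r; apply: MB. Qed.

Lemma M_addr x y : M x -> M y -> M (x + y).
Proof. by move=> Mx My; rewrite -[y]opprK; apply/MB/M_oppr. Qed.

Lemma M_mulrn x k : M x -> M (x *+ k).
Proof. by move=> Mx; elim: k => // k IH; rewrite mulrS; apply: M_addr. Qed.

Lemma M_mulrz x (k : int) : M x -> M (x *~ k).
Proof.
by move=> Mx; case: k => k; rewrite ?NegzE ?mulrNz; [|apply: M_oppr];
  apply: M_mulrn.
Qed.

Definition over n (C : seq (lit n)) : Prop := forall l, l \in C -> M l.2.2.

Definition semilinear n (S : set 'rV[G]_n) : Prop :=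
  exists E : seq (seq (lit n)),
    (forall C, C \in E -> over C) /\
    forall v, S v <-> exists2 C, C \in E & sat C v.

Lemma sat_cat n (C1 C2 : seq (lit n)) v :
  sat (C1 ++ C2) v <-> sat C1 v /\ sat C2 v.
Proof.
split=> [h|[h1 h2] l]; last by rewrite mem_cat => /orP[/h1|/h2].
by split=> l lC; apply: h; rewrite mem_cat lC ?orbT.
Qed.

Lemma over_cat n (C1 C2 : seq (lit n)) : over C1 -> over C2 -> over (C1 ++ C2).
Proof. by move=> h1 h2 l; rewrite mem_cat => /orP[/h1|/h2]. Qed.

Lemma semilinear_ext n (S T : set 'rV[G]_n) :
  (forall v, S v <-> T v) -> semilinear S -> semilinear T.
Proof. by move=> ST [E [ME hE]]; exists E; split=> // v; rewrite -ST hE. Qed.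

Lemma semilinear_sat n (C : seq (lit n)) : over C -> semilinear (sat C).
Proof.
move=> MC; exists [:: C]; split=> [C'|v]; first by rewrite inE => /eqP->.
by split=> [h|[C']]; [exists C; rewrite ?mem_head|rewrite inE => /eqP->].
Qed.

Lemma semilinearI n (S T : set 'rV[G]_n) :
  semilinear S -> semilinear T -> semilinear (fun v => S v /\ T v).
Proof.
move=> [E [ME hE]] [F [MF hF]].
exists [seq C1 ++ C2 | C1 <- E, C2 <- F]; split=> [C|v].
  by move/allpairsP => [[C1 C2] /= [/ME h1 /MF h2 ->]]; apply: over_cat.
rewrite hE hF; split=> [[[C1 h1 s1] [C2 h2 s2]]|[C]].
  exists (C1 ++ C2); last exact/sat_cat.
  by apply/allpairsP; exists (C1, C2).
move/allpairsP => [[C1 C2] /= [h1 h2 ->]] /sat_cat[s1 s2].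
by split; [exists C1|exists C2].
Qed.

Lemma semilinear_negsat n (C : seq (lit n)) :
  over C -> semilinear (fun v => ~ sat C v).
Proof.
move=> MC; exists [seq [:: (~~ l.1, - l.2)] | l <- C]; split=> [C'|v].
  move=> /mapP[l lC ->] k; rewrite inE => /eqP-> /=; exact/M_oppr/MC.
split=> [|[C' /mapP[l lC ->] hl /(_ l lC)]].
  move=> /existsNP[l /not_implyP[lC /negP hl]].
  exists [:: (~~ l.1, - l.2)]; first by apply/mapP; exists l.
  by move=> k; rewrite inE => /eqP-> /=; rewrite aevalN posN negbK.
have := hl _ (mem_head _ _).
by rewrite /= aevalN posN negbK => /negP.
Qed.

Lemma semilinearC n (S : set 'rV[G]_n) :
  semilinear S -> semilinear (fun v => ~ S v).
Proof.
move=> [E [ME hE]].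
suff: semilinear (fun v => ~ exists2 C, C \in E & sat C v).
  by apply: semilinear_ext => v; rewrite hE.
elim: E ME {S hE} => [|C E IH] ME.
  apply: semilinear_ext (@semilinear_sat n [::] _) => // v.
  by split=> _ // [].
have MC : over C by apply: ME; rewrite mem_head.
have /IH hE C' : C' \in E -> over C' by move=> h; apply: ME; rewrite inE h orbT.
apply: semilinear_ext (semilinearI (semilinear_negsat MC) hE) => v.
split=> [[nC nE] [C']|h].
  by rewrite inE => /orP[/eqP->//|C'E ?]; apply: nE; exists C'.
split=> [hC|[C' C'E hC']]; apply: h; first by exists C; rewrite ?mem_head.
by exists C'; rewrite // inE C'E orbT.
Qed.

Lemma fm_over n (C : seq (lit n.+1)) : over C -> over (fm C).
Proof.
move=> MC k /fmP[[l lC [_ ->]]|[p [q [/MC pC /MC qC _ _ ->]]]]; first exact: MC.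
have E (a b : aff n) : (a + b).2 = a.2 + b.2 by [].
have E' (a : aff n) i : (a *+ i).2 = a.2 *+ i.
  by elim: i => // i IH; rewrite !mulrS E IH.
by rewrite E !E'; apply: M_addr; apply: M_mulrn.
Qed.

Lemma semilinear_proj n (S : set 'rV[G]_n.+1) :
  semilinear S -> semilinear (fun v => exists y, S (vcons y v)).
Proof.
move=> [E [ME hE]]; exists [seq fm C | C <- E].
split=> [C /mapP[C' /ME h ->]|v].
  exact: fm_over.
split=> [[y /hE[C CE hC]]|[C' /mapP[C CE ->]] /fm_elim[y hy]].
  by exists (fm C); [apply/mapP; exists C|apply/fm_elim; exists y].
by exists y; apply/hE; exists C.
Qed.

Lemma term_aff n (t : term n) :
  exists2 l : aff n, l.2 = 0 & forall v, eval t v = aeval l v.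
Proof.
elim: t => [i||t [l l0 hl] u [k k0 hk]|t [l l0 hl]].
- exists (delta_mx 0 i, 0) => // v; rewrite /aeval addr0 (bigD1 i)//=.
  rewrite mxE !eqxx mulr1z big1 ?addr0// => j /negPf ji.
  by rewrite mxE ji mulr0z.
- by exists 0 => // v; rewrite aeval0.
- exists (l + k); first by rewrite /= l0 k0 addr0.
  by move=> v; rewrite aevalD /= hl hk.
- exists (- l); first by rewrite /= l0 oppr0.
  by move=> v; rewrite aevalN /= hl.
Qed.

Lemma semilinear_pos n s (t u : term n) :
  semilinear (fun v => pos s (eval u v - eval t v)).
Proof.
have [l l0 hl] := term_aff t; have [k k0 hk] := term_aff u.
apply: semilinear_ext (@semilinear_sat n [:: (s, k - l)] _) => [v|].
  rewrite hl hk -aevalN -aevalD; split=> [h|h x].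
    exact: (h _ (mem_head _ _)).
  by rewrite inE => /eqP->.
by move=> x; rewrite inE => /eqP->/=; rewrite l0 k0 subr0.
Qed.

(** The formula has no parameters: they are variables here, and are substituted
    afterwards by [semilinear_subst]. *)
Lemma holds_semilinear n (phi : formula n) : semilinear (holds (G := G) phi).
Proof.
elim: phi => {n} [n t u|n t u|n p hp q hq|n p hp|n p hp] /=.
- apply: semilinear_ext
    (semilinearI (semilinear_pos false t u) (semilinear_pos false u t)) => v /=.
  rewrite !og_subr_ge0; split=> [[h1 h2]|->]; last by rewrite lexx.
  by apply: le_anti; rewrite h1.
- apply: semilinear_ext (semilinear_pos true t u) => v /=.
  by rewrite og_subr_gt0.
- exact: semilinearI.
- exact: semilinearC.
- exact: semilinear_proj.
Qed.

Lemma aeval_row_mx m k (l : aff (m + k)) (x : 'rV[G]_m) (a : 'rV[G]_k) :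
  aeval l (row_mx x a) =
  \sum_i x 0 i *~ l.1 0 (lshift k i) +
  (\sum_j a 0 j *~ l.1 0 (rshift m j) + l.2).
Proof.
rewrite /aeval big_split_ord /= -addrA; congr (_ + (_ + _)).
  by apply: eq_bigr => i _; rewrite row_mxEl.
by apply: eq_bigr => i _; rewrite row_mxEr.
Qed.

Lemma semilinear_subst m k (S : set 'rV[G]_(m + k)) (a : 'rV[G]_k) :
  (forall j, M (a 0 j)) -> semilinear S ->
  semilinear (fun x : 'rV[G]_m => S (row_mx x a)).
Proof.
move=> Ma [E [ME hE]].
pose f (l : lit (m + k)) : lit m := (l.1, (\row_i l.2.1 0 (lshift k i),
  \sum_j a 0 j *~ l.2.1 0 (rshift m j) + l.2.2)).
have fE l (x : 'rV[G]_m) : aeval (f l).2 x = aeval l.2 (row_mx x a).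
  rewrite aeval_row_mx /aeval /=; congr (_ + _).
  by apply: eq_bigr => i _; rewrite mxE.
exists [seq [seq f l | l <- C] | C <- E]; split=> [_ /mapP[C /ME MC ->]|x].
  move=> _ /mapP[l /MC Ml ->] /=; apply: M_addr => //.
  by apply: (big_ind M) => // [|j _]; [apply: M_addr|apply: M_mulrz].
rewrite hE; split=> [[C CE hC]|[_ /mapP[C CE ->] hC]].
  exists [seq f l | l <- C]; first by apply/mapP; exists C.
  by move=> _ /mapP[l lC ->]; rewrite fE; apply: hC.
exists C => // l lC; rewrite -fE; apply: (hC (f l)).
by apply/mapP; exists l.
Qed.

Lemma definable_semilinear m (D : set 'rV[G]_m) :
  definable M D -> semilinear D.
Proof.
move=> [k [phi [a [Ma hD]]]].
apply: semilinear_ext (semilinear_subst Ma (holds_semilinear phi)) => x.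
by rewrite hD.
Qed.

(** * Lower approximations by lattice-group expressions *)

Lemma qscaleP q (x : G) : qscale q x *~ denq q = x *~ numq q.
Proof.
apply: (@xgetPex _ 0 [set y | y *~ denq q = x *~ numq q]).
by have [y hy] := og_divz (x *~ numq q) (denq_neq0 q); exists y.
Qed.

Lemma Qaffine_clear m (h : 'rV[G]_m -> G) : Qaffine M h ->
  exists (d : nat) (l : aff m),
    [/\ (0 < d)%N, M l.2 & forall x : 'rV[G]_m, h x *+ d = aeval l x].
Proof.
move=> [q [c [Mc hE]]]; pose d := \prod_i denq (q i).
have d0 : 0 < d by apply: prodr_gt0 => i _; apply: denq_gt0.
exists `|d|%N, (\row_i (numq (q i) * \prod_(j | j != i) denq (q j)), c *~ d).
split=> [||x]; [by rewrite absz_gt0 gt_eqF|exact: M_mulrz|].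
rewrite pmulrn gtz0_abs // hE mulrzDl mulrz_suml; congr (_ + _).
apply: eq_bigr => i _; rewrite mxE /d (bigD1 i) //= !mulrzA.
by rewrite qscaleP.
Qed.

(** The total violation of the system C at v.  A sum of positive parts is used
    instead of their maximum: it dominates each of them equally well. *)
Definition excess n (C : seq (lit n)) (v : 'rV[G]_n) : G :=
  \sum_(l <- C) Order.max 0 (- aeval l.2 v).

Lemma excess_ge0 n (C : seq (lit n)) v : 0 <= excess C v.
Proof.
by apply: (big_ind (fun x => 0 <= x)) => [//||l _];
  [exact: og_addr_ge0|rewrite og_le_max lexx].
Qed.

Lemma excess_ge n (C : seq (lit n)) v l :
  l \in C -> - aeval l.2 v <= excess C v.
Proof.
elim: C => // k C IH; rewrite inE /excess big_cons => /orP[/eqP->|/IH h].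
  rewrite -[X in X <= _]addr0; apply: og_leD; last exact: excess_ge0.
  by rewrite og_le_max lexx orbT.
rewrite -[X in X <= _]add0r; apply: og_leD => //.
by rewrite og_le_max lexx.
Qed.

Lemma excess0 n (C : seq (lit n)) v : sat C v -> excess C v = 0.
Proof.
rewrite /excess => h; rewrite big_seq big1 // => l /h /pos_ge0 l0.
apply: le_anti; rewrite og_ge_max lexx -og_oppr_ge0 opprK l0 /=.
by rewrite og_le_max lexx.
Qed.

Section Expr.
Variables (m : nat) (F : set ('rV[G]_m -> G)).
Hypothesis Fconst : forall c, M c -> F (@const_fun G m c).
Hypothesis Fcoord : forall j, F (@coord_fun G m j).
Implicit Types (x : 'rV[G]_m) (h : 'rV[G]_m -> G).

Lemma lplus_ext h1 h2 : (forall x, h1 x = h2 x) ->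
  lplus_expr F h1 -> lplus_expr F h2.
Proof. by move=> /funext ->. Qed.

Lemma lplus_const c : M c -> lplus_expr F (fun=> c).
Proof. by move=> Mc; apply/LP_gen/Fconst. Qed.

Lemma lplus_mulrn h k : lplus_expr F h -> lplus_expr F (fun x => h x *+ k).
Proof.
move=> hF; elim: k => [|k IH]; first exact: lplus_const.
by apply: lplus_ext (LP_add hF IH) => x; rewrite mulrS.
Qed.

Lemma lplus_mulrz h (k : int) :
  lplus_expr F h -> lplus_expr F (fun x => h x *~ k).
Proof.
move=> hF; case: k => k; first exact: lplus_mulrn.
apply: lplus_ext (LP_sub (lplus_const M0) (lplus_mulrn k.+1 hF)) => x.
by rewrite sub0r NegzE mulrNz.
Qed.

Lemma lplus_sum (I : Type) (r : seq I) (h : I -> 'rV[G]_m -> G) :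
  (forall i, lplus_expr F (h i)) -> lplus_expr F (fun x => \sum_(i <- r) h i x).
Proof.
move=> hF; elim: r => [|i r IH].
  by apply: lplus_ext (lplus_const M0) => x; rewrite big_nil.
by apply: lplus_ext (LP_add (hF i) IH) => x; rewrite big_cons.
Qed.

Lemma lplus_aeval (l : aff (m + 1)) h : M l.2 -> lplus_expr F h ->
  lplus_expr F (fun x => aeval l (row_mx x (const_mx (h x)))).
Proof.
move=> Ml hF; have hc : lplus_expr F (fun x =>
    \sum_(i < m) x 0 i *~ l.1 0 (lshift 1 i)).
  by apply: lplus_sum => i; apply/lplus_mulrz/LP_gen/Fcoord.
have hl := lplus_mulrz (l.1 0 (rshift m 0)) hF.
have := LP_add hc (LP_add hl (lplus_const Ml)).
by apply: lplus_ext => x; rewrite aeval_row_mx big_ord1 mxE.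
Qed.

Lemma lplus_excess (C : seq (lit (m + 1))) h : over C -> lplus_expr F h ->
  lplus_expr F (fun x => excess C (row_mx x (const_mx (h x)))).
Proof.
move=> MC hF; rewrite /excess; elim: C MC => [|l C IH] MC.
  by apply: lplus_ext (lplus_const M0) => x; rewrite big_nil.
have hl : lplus_expr F (fun x => Order.max 0
    (0 - aeval l.2 (row_mx x (const_mx (h x))))).
  apply: (LP_max (lplus_const M0) (LP_sub (lplus_const M0) _)).
  by apply: lplus_aeval => //; apply: MC; rewrite mem_head.
apply: lplus_ext (LP_add hl (IH _)) => [x|k kC].
  by rewrite big_cons sub0r.
by apply: MC; rewrite inE kC orbT.
Qed.

(** The function is f - R e with e the excess of C along the graph of f.  The
    error bound is applied to C together with the equation y = f x of that
    graph; the point (x, f x) satisfies the added equation exactly, so only C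
    contributes to the excess, and the nearby solution is again of the form
    (z, f z). *)
Lemma lower_piece (D : set 'rV[G]_m) (g f : 'rV[G]_m -> G)
    (C : seq (lit (m + 1))) (pt := fun x => row_mx x (const_mx (f x))) :
  lipschitz D g -> F f -> Qaffine M f -> over C ->
  (forall x, sat C (pt x) -> D x /\ g x = f x) -> (exists x, sat C (pt x)) ->
  exists h, [/\ lplus_expr F h, forall x, D x -> h x <= g x &
                forall x, sat C (pt x) -> h x = g x].
Proof.
move=> [N gL] Ff /Qaffine_clear[d [l [d0 Ml fE]]] MC CD [x0 hx0].
pose e : aff (m + 1) := (row_mx l.1 (const_mx (- d%:Z)), l.2).
have eE x y : aeval e (row_mx x (const_mx y)) = aeval l x - y *+ d.
  rewrite aeval_row_mx big_ord1 /= row_mxEr !mxE mulrNz -pmulrn.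
  rewrite /aeval -[RHS]addrA; congr (_ + _); last exact: addrC.
  by apply: eq_bigr => i _; rewrite row_mxEl.
(* e = 0 is the equation d y = d f x, with denominators cleared. *)
pose C' := C ++ [:: (false, e); (false, - e)].
have C'E x y : sat C' (row_mx x (const_mx y)) -> y = f x /\ sat C (pt x).
  move=> /sat_cat[hC he]; suff yE : y = f x by rewrite /pt -yE.
  have := he (false, e) (mem_head _ _).
  have := he (false, - e); rewrite inE mem_head orbT => /(_ isT) /=.
  rewrite aevalN og_oppr_ge0 eE => h1 h2; apply: (og_mulrn_inj d0).
  apply/esym/eqP; rewrite fE -subr_eq0; apply/eqP/le_anti.
  by rewrite h1 h2.
have [|K hK] := @hoffman _ C'.
  exists (pt x0); apply/sat_cat; split=> // k; rewrite !inE.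
  by move=> /orP[] /eqP-> /=; rewrite ?aevalN eE fE subrr ?oppr0 lexx.
have [S hS] := aeval_lipschitz l.
(* S bounds the slope of d f, hence that of f; N bounds that of g; and K is the
   constant of the error bound. *)
pose R := (K * (S + N))%N.
exists (fun x => f x - excess C (pt x) *+ R); split.
- apply: LP_sub; first exact: LP_gen.
  by apply: lplus_mulrn; apply: lplus_excess => //; apply: LP_gen.
- move=> x Dx; apply: og_le_limit => r Er.
  have r0 : 0 < r := le_lt_trans (excess_ge0 C (pt x)) Er.
  have [//||w hw xw] := hK (pt x) r.
    move=> k; rewrite mem_cat !inE => /orP[kC|].
      rewrite -[aeval _ _]opprK addrC og_subr_gt0.
      apply: le_lt_trans Er; exact: excess_ge.
    by move=> /orP[] /eqP-> /=; rewrite ?aevalN eE fE subrr ?oppr0 add0r.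
  have [z [y wE]] : exists z y, w = row_mx z (const_mx y).
    exists (lsubmx w), (rsubmx w 0 0); rewrite -[LHS]hsubmxK; congr row_mx.
    by apply/matrixP => i j; rewrite !ord1 [RHS]mxE.
  have [yE hz] : y = f z /\ sat C (pt z) by apply: C'E; rewrite -wE.
  have [Dz gz] := CD z hz.
  have rK : 0 <= r *+ K by rewrite og_mulrn_ge0 // ltW.
  have xz : norm (x - z) <= r *+ K.
    rewrite norm_le //; apply/forallP => i; apply: le_trans xw.
    have := abs_le_norm (pt x - w) (lshift 1 i).
    by rewrite !row_subE wE /pt !row_mxEl.
  have h1 : f x - f z <= r *+ K *+ S.
    apply: (og_mulrn_le d0); first exact: og_mulrn_ge0.
    by rewrite mulrnBl !fE; apply: hS.
  have h2 : f z - g x <= r *+ K *+ N.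
    rewrite -gz -opprB; have := gL x z Dx Dz; rewrite abs_le => /andP[_].
    by move=> /le_trans; apply; apply: og_leMn.
  have := og_leD h1 h2; rewrite addrA subrK -mulrnDr -mulrnA -/R.
  by rewrite !og_lerBl addrC.
- by move=> x hx; rewrite excess0 // mul0rn subr0; case: (CD x hx).
Qed.

(** Empty pieces impose nothing and have no lower approximation to contribute,
    so the induction has to allow for a family all of whose pieces are empty;
    if D itself is empty any constant serves. *)
Lemma lplus_of_pieces (D : set 'rV[G]_m) (g : 'rV[G]_m -> G) (I : eqType)
    (s : seq I) (P : I -> set 'rV[G]_m) :
  (forall x, D x -> exists2 i, i \in s & P i x) ->
  (forall i, i \in s -> (exists x, P i x) ->
     exists h, [/\ lplus_expr F h, forall x, D x -> h x <= g x &
                   forall x, P i x -> h x = g x]) ->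
  lplus_combination D F g.
Proof.
move=> cover pieces.
suff: forall r : seq I, {subset r <= s} -> (forall i x, i \in r -> ~ P i x) \/
    exists h, [/\ lplus_expr F h, forall x, D x -> h x <= g x &
              forall i x, i \in r -> P i x -> D x -> h x = g x].
  move=> /(_ s (fun _ => id)) [none|[h [hF _ hE]]].
    exists (fun=> 0); first exact: lplus_const.
    by move=> x /cover[i si] /(none i x si).
  by exists h => // x Dx; have [i si Px] := cover x Dx; rewrite (hE i).
elim=> [|i r IH] rs; first by left.
have {}IH := IH (fun j jr => rs j (mem_behead (s := i :: r) jr)).
case: (pselect (exists x, P i x)) => [Pi|Pi]; last first.
  have none x : ~ P i x by move=> ?; apply: Pi; exists x.
  case: IH => [none'|[h [hF hg hE]]].
    by left=> j x; rewrite inE => /orP[/eqP->|]; [exact: none|exact: none'].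
  right; exists h; split=> // j x; rewrite inE => /orP[/eqP-> /none//|].
  exact: hE.
right; have [h [hF hg hE]] := pieces i (rs i (mem_head _ _)) Pi.
case: IH => [none'|[k [kF kg kE]]].
  exists h; split=> // j x; rewrite inE => /orP[/eqP-> /hE-> //|jr Pj].
  by case: (none' j x jr).
exists (fun x => Order.max (h x) (k x)); split; first exact: LP_max.
  by move=> x Dx; rewrite og_ge_max hg ?kg.
move=> j x; rewrite inE => jr Pj Dx; apply: le_anti.
rewrite og_ge_max hg ?kg // og_le_max.
case/orP: jr Pj => [/eqP->|jr] Pj; first by rewrite hE ?lexx.
by rewrite (kE j) // lexx orbT.
Qed.

End Expr.
End Semilinear.
End OrderedGroup.

(** * The theorem *)

Theorem theorem3p13 (G : porderZmodType) (M : set G)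
    (hG : doag [set: G]) (hM : doag M \/ M = [set 0])
    (m : nat) (D : set 'rV[G]_m) (hD : definable M D)
    (g : 'rV[G]_m -> G) (hgM : definable_fun M D g) (hgL : lipschitz D g)
    (n : nat) (f : 'I_n -> 'rV[G]_m -> G)
    (hf : forall i, Qaffine M (f i)) (hw : w_combination D f g) :
  lplus_combination D
    (range f `|` [set const_fun c | c in M] `|` range (@coord_fun G m)) g.
Proof.
have [M0 MB] : M 0 /\ forall x y, M x -> M y -> M (x - y).
  by case: hM => [[]//|->]; split=> // x y -> ->; rewrite /= subr0.
set F := _ `|` _.
have Fconst c : M c -> F (@const_fun G m c) by move=> Mc; left; right; exists c.
have Fcoord j : F (@coord_fun G m j) by right; exists j.
have [E [ME hE]] := definable_semilinear hG M0 MB hgM.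
have graphP x y : graph D g (row_mx x (const_mx y)) <-> D x /\ g x = y.
  split=> [[z Dz /eq_row_mx[zx /matrixP/(_ 0 0)]]|[Dx <-]]; last by exists x.
  by rewrite !mxE -zx.
pose pt (i : 'I_n) x := row_mx x (const_mx (f i x) : 'rV[G]_1).
apply: (lplus_of_pieces hG M0 Fconst
  (s := [seq (C, i) | C <- E, i <- enum 'I_n])
  (P := fun p x => sat p.1 (pt p.2 x))).
  move=> x Dx; have [_ _ /(_ x Dx) [i gx]] := hw.
  have [|C CE hC] := (hE (pt i x)).1; first by apply/graphP.
  by exists (C, i) => //; apply/allpairsP; exists (C, i); rewrite mem_enum.
move=> _ /allpairsP[[C i] /= [CE _ ->]] /= ne.
apply: (lower_piece hG M0 MB Fconst Fcoord hgL _ (hf i) (ME C CE) _ ne).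
  by left; left; exists i.
by move=> x hx; apply/graphP/hE; exists C.
Qed.
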